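(* Let $\mathcal{B}$ be a $C^*$-algebra and let $E$ be a full Hilbert $\mathcal{B}$-module. Then the group of generalized unitaries on $E$ coincides with the group of ternary automorphisms of $E$. Therefore, the dynamical systems on $E$ are exactly the $C_0$-groups of ternary automorphisms of $E$.
   Context: Hilbert modules are right modules with inner product linear in the second argument; $E$ is full if $\mathrm{span}\,\langle E,E\rangle$ is dense in $\mathcal{B}$. A generalized unitary on $E$ is a surjection $u\colon E\to E$ for which there is a ($*$-)automorphism $\varphi$ of $\mathcal{B}$ with $\langle ux,uy\rangle=\varphi(\langle x,y\rangle)$ for all $x,y\in E$. A ternary automorphism of $E$ is a bijection $u$ on $E$ with $u(x\langle y,z\rangle)=(ux)\langle uy,uz\rangle$ for all $x,y,z\in E$. A dynamical system on $E$ is a strongly continuous one-parameter group $(u_t)_{t\in\mathbb{R}}$ of generalized unitaries on $E$. A $C_0$-group on $E$ is a strongly continuous one-parameter group of (linear) Banach space isometries of $E$.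
   Formalization: Ternary automorphisms are additionally required to be linear; without linearity the claim fails, e.g. complex conjugation on E = B = C is a bijection satisfying the ternary identity but is not a generalized unitary. *)

(* Defs.v *)
From HB Require Import structures.
From mathcomp Require Import all_boot all_order all_algebra.
From mathcomp Require Import all_classical all_reals all_analysis.
From mathcomp Require Import complex.

Set Implicit Arguments.
Unset Strict Implicit.
Unset Printing Implicit Defensive.

Import Order.TTheory GRing.Theory Num.Theory.
Import numFieldNormedType.Exports.

Local Open Scope classical_set_scope.
Local Open Scope complex_scope.
Local Open Scope ring_scope.

(* C*-algebras need not have a unit, so the product cannot come from the ring
   hierarchy (whose rings are unital).  The norm of a normed module over R[i]
   takes values in R[i]. *)
HB.mixin Record CompleteNormedModule_isCStarAlgebra (R : realType) B
    of CompleteNormedModule R[i] B := {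
  cmul : B -> B -> B ;
  star : B -> B ;
  cmulA : forall a b c, cmul a (cmul b c) = cmul (cmul a b) c ;
  cmul_linearl : forall b, linear (fun a => cmul a b) ;
  cmul_linearr : forall a, linear (cmul a) ;
  star_antilinear : forall (l : R[i]) a b,
    star (l *: a + b) = Num.conj l *: star a + star b ;
  starM : forall a b, star (cmul a b) = cmul (star b) (star a) ;
  starK : forall a, star (star a) = a ;
  cmul_norm_le : forall a b, `|cmul a b| <= `|a| * `|b| ;
  cstar_identity : forall a, `|cmul (star a) a| = `|a| ^+ 2
}.

#[short(type="cstarAlgType")]
HB.structure Definition CStarAlgebra (R : realType) :=
  {B of CompleteNormedModule R[i] B & CompleteNormedModule_isCStarAlgebra R B}.

Definition cstar_positive (R : realType) (B : cstarAlgType R) (a : B) : Prop :=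
  exists b : B, a = cmul (star b) b.

HB.mixin Record CompleteNormedModule_isHilbertModule
    (R : realType) (B : cstarAlgType R) E of CompleteNormedModule R[i] E := {
  ract : E -> B -> E ;
  ip : E -> E -> B ;
  ract_linearl : forall b, linear (fun x => ract x b) ;
  ract_linearr : forall x, linear (ract x) ;
  ractM : forall x a b, ract x (cmul a b) = ract (ract x a) b ;
  ip_linearr : forall x, linear (ip x) ;
  ip_ractr : forall x y b, ip x (ract y b) = cmul (ip x y) b ;
  star_ip : forall x y, star (ip x y) = ip y x ;
  ip_positive : forall x, cstar_positive (ip x x) ;
  ip_definite : forall x, ip x x = 0 -> x = 0 ;
  (* the given complete norm of E is the one defined by the inner product *)
  norm_ip : forall x, `|x| = sqrtC `|ip x x|
}.

#[short(type="hilbertModType")]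
HB.structure Definition HilbertModule (R : realType) (B : cstarAlgType R) :=
  {E of CompleteNormedModule R[i] E & CompleteNormedModule_isHilbertModule R B E}.

Section Algebra.
Context {R : realType} {B : cstarAlgType R}.

Definition linear_span (A : set B) : set B :=
  [set v | exists (n : nat) (c : 'I_n -> R[i]) (f : 'I_n -> B),
     (forall i, A (f i)) /\ v = \sum_i c i *: f i].

Definition star_automorphism (phi : B -> B) : Prop :=
  [/\ linear phi,
      forall a b, phi (cmul a b) = cmul (phi a) (phi b),
      forall a, phi (star a) = star (phi a)
    & bijective phi].

End Algebra.

Section HilbertModules.
Context {R : realType} {B : cstarAlgType R}.

Definition full (E : hilbertModType B) : Prop :=
  dense (linear_span [set ip x y | x in [set: E] & y in [set: E]]).

Section Maps.
Context {E : hilbertModType B}.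

Definition generalized_unitary : set (E -> E) :=
  [set u | (forall y, exists x, u x = y) /\
     exists2 phi : B -> B, star_automorphism phi &
       forall x y, ip (u x) (u y) = phi (ip x y)].

(* Linearity is part of the notion: complex conjugation on E = B = C satisfies
   the ternary identity, but it is not a generalized unitary. *)
Definition ternary_automorphism : set (E -> E) :=
  [set u | [/\ linear u, bijective u &
     forall x y z, u (ract x (ip y z)) = ract (u x) (ip (u y) (u z))]].

Definition transformation_group (G : set (E -> E)) : Prop :=
  [/\ G id,
      forall u v, G u -> G v -> G (u \o v)
    & forall u, G u -> exists v, [/\ G v, cancel u v & cancel v u]].

Definition one_parameter_group (u : R -> E -> E) : Prop :=
  u 0 = id /\ forall s t, u (s + t) = u s \o u t.

Definition strongly_continuous (u : R -> E -> E) : Prop :=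
  forall x : E, continuous (fun t : R => u t x).

Definition dynamical_system (u : R -> E -> E) : Prop :=
  [/\ one_parameter_group u, strongly_continuous u
    & forall t, generalized_unitary (u t)].

Definition linear_isometry (v : E -> E) : Prop :=
  linear v /\ forall x, `|v x| = `|x|.

Definition C0_group (u : R -> E -> E) : Prop :=
  [/\ one_parameter_group u, strongly_continuous u
    & forall t, linear_isometry (u t)].

End Maps.
End HilbertModules.

(* Main.v *)
(** A generalized unitary is linear and ternary because <uz, w> = 0 for all z
    forces w = 0.  Conversely, for a ternary u let b correspond to a when
    u(xa) = (ux)b for all x.  Fullness makes b unique, the correspondence
    respects the *-algebra operations, and <ux, uy> corresponds to <x, y>, so
    everything reduces to defining it on all of B, which follows from
    |b| <= |a| on the right ideal span <E, E>, by completeness.  For a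
    selfadjoint of norm at most 1/2 in that ideal, 1 + d - ia with
    d = sqrt(1 - a^2) - 1 is a unitary and d is again in the ideal; so the
    image of 1 + d - ia is a unitary too, whence |b| <= 2.  Thus |b| <= 4|a| for
    selfadjoint a, and passing to the powers a^(2^n) removes the constant. *)

Require Import Defs.
From HB Require Import structures.
From mathcomp Require Import all_boot all_order all_algebra.
From mathcomp Require Import all_classical all_reals all_analysis.
From mathcomp Require Import complex ring lra.

Set Implicit Arguments.
Unset Strict Implicit.
Unset Printing Implicit Defensive.

Import Order.TTheory GRing.Theory Num.Theory.
Import numFieldNormedType.Exports.

Local Open Scope classical_set_scope.
Local Open Scope ring_scope.

(** * Linear maps given as bare functions with a linearity hypothesis *)

Section LinearMaps.
Context {K : pzRingType} {U V : lmodType K} {f : U -> V}.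
Hypothesis lf : linear f.

Let fL : {linear U -> V} := HB.pack f (GRing.isLinear.Build K U V *:%R f lf).

Lemma lin0 : f 0 = 0. Proof. exact: (linear0 fL). Qed.
Lemma linD x y : f (x + y) = f x + f y. Proof. exact: (linearD fL). Qed.
Lemma linB x y : f (x - y) = f x - f y. Proof. exact: (linearB fL). Qed.
Lemma linZ k x : f (k *: x) = k *: f x.
Proof. exact: (GRing.scalable_linear lf). Qed.

Lemma lin_can g : cancel f g -> cancel g f -> linear g.
Proof. exact: (@can2_linear K U V fL g). Qed.

End LinearMaps.

(** * Real-valued norms and convergence at a geometric rate *)

Section RealNorm.
Context {R : realType}.

Lemma ge0_ReK (z : R[i]) : 0 <= z -> (complex.Re z)%:C%C = z.
Proof. by move=> z0; apply/RRe_real/ger0_real. Qed.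

(* The norm of a normed module over [R[i]] takes values in [R[i]]; its real
   part lives in a totally ordered field. *)
Definition nrm {V : normedModType R[i]} (x : V) : R := complex.Re `|x|.

Section Theory.
Context {V : normedModType R[i]}.
Implicit Types x y : V.

Lemma nrmE x : `|x| = (nrm x)%:C%C.
Proof. exact/esym/ge0_ReK/normr_ge0. Qed.

Lemma nrm_ge0 x : 0 <= nrm x.
Proof. by rewrite -lecR -nrmE; exact: normr_ge0. Qed.

Lemma nrm0 : nrm (0 : V) = 0.
Proof. by rewrite /nrm normr0. Qed.

Lemma nrm0_eq0 x : nrm x = 0 -> x = 0.
Proof. by move=> x0; apply/normr0_eq0; rewrite nrmE x0. Qed.

Lemma nrmN x : nrm (- x) = nrm x.
Proof. by rewrite /nrm normrN. Qed.

Lemma nrmBC x y : nrm (x - y) = nrm (y - x).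
Proof. by rewrite -nrmN opprB. Qed.

Lemma nrmD x y : nrm (x + y) <= nrm x + nrm y.
Proof. by rewrite -lecR rmorphD/= -!nrmE ler_normD. Qed.

Lemma nrmB x y : nrm (x - y) <= nrm x + nrm y.
Proof. by rewrite -(nrmN y) nrmD. Qed.

Lemma nrm_triangle y x z : nrm (x - z) <= nrm (x - y) + nrm (y - z).
Proof. by apply: le_trans (nrmD _ _); rewrite addrA subrK. Qed.

Lemma nrmZ (k : R[i]) x : nrm (k *: x) = complex.Re `|k| * nrm x.
Proof.
by rewrite {1}/nrm normrZ nrmE -{1}(ge0_ReK (normr_ge0 k)) -rmorphM.
Qed.

Lemma nrmZR (r : R) x : 0 <= r -> nrm (r%:C%C *: x) = r * nrm x.
Proof. by move=> r0; rewrite nrmZ ger0_norm// lecR. Qed.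

Lemma nrmZi x : nrm ('i *: x) = nrm x.
Proof. by rewrite nrmZ normCi mul1r. Qed.

End Theory.

Lemma half_pow_small (C e : R) : 0 < e -> exists n, C * 2^-1 ^+ n < e.
Proof.
move=> e0; exists (Num.bound (C / e)).
have := @upper_nthrootP R (C / e) _ (leqnn _).
by rewrite exprVn ltr_pdivrMr ?exprn_gt0// ltr_pdivrMr// mulrC.
Qed.

Lemma half_pow_gt0 n : 0 < 2^-1 ^+ n :> R.
Proof. by rewrite exprn_gt0// invr_gt0. Qed.

Lemma nrm_half_pow_eq0 (V : normedModType R[i]) (C : R) (x : V) :
  (forall n, nrm x <= C * 2^-1 ^+ n) -> x = 0.
Proof.
move=> xle; apply: nrm0_eq0; apply/le_anti; rewrite nrm_ge0 andbT.
apply/ler_addgt0Pr => e /(half_pow_small C)[n /ltW]; rewrite add0r.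
exact/le_trans.
Qed.

(** The factor 2 leaves room for comparing [x n] with a later term that is merely 2^-n close to the
    limit. *)
Lemma half_pow_cauchy_cvg (V : completeNormedModType R[i]) (x : nat -> V) :
  (forall n k, nrm (x (n + k)%N - x n) <= 2^-1 ^+ n) ->
  exists l, forall n, nrm (x n - l) <= 2 * 2^-1 ^+ n.
Proof.
move=> xC; have /cauchy_cvg xcvg : cauchy (x @ \oo).
  apply: cauchy_exP => e e0.
  have eE : e = (complex.Re e)%:C%C by rewrite ge0_ReK// ltW.
  have /(half_pow_small 1)[n] : 0 < complex.Re e by rewrite -ltcR -eE.
  rewrite mul1r => ne; exists (x n); exists n => // m /= nm.
  rewrite -ball_normE/= nrmE eE ltcR nrmBC.
  by apply: le_lt_trans ne; rewrite -(subnKC nm).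
exists (lim (x @ \oo)) => n.
have d0 : 0 < (2^-1 ^+ n)%:C%C :> R[i] by rewrite ltcR half_pow_gt0.
have /cvgrPdist_lt/(_ _ d0)[m _ xm] := xcvg.
have := xm (n + m)%N (leq_addl _ _); rewrite nrmE ltcR nrmBC => h.
have := xC n m; rewrite nrmBC.
have := nrm_triangle (x (n + m)%N) (x n) (lim (x @ \oo)).
by move: h; lra.
Qed.

Lemma bernoulli_ineq (h : R) m : 0 <= h -> 1 + m%:R * h <= (1 + h) ^+ m.
Proof.
move=> h0; elim: m => [|m IH]; first by rewrite mul0r addr0 expr0.
rewrite exprS -natr1; have : (0 : R) <= m%:R by [].
by move: IH; move: ((1 + h) ^+ m) (m%:R : R) => p k; nra.
Qed.

(** If y > x > 0, the powers (y/x)^(2^n) would all be at most C, against Bernoulli's inequality. *)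
Lemma le_of_pow2_le (x y C : R) : 0 <= x -> 0 <= y ->
  (forall n, y ^+ (2 ^ n) <= C * x ^+ (2 ^ n)) -> y <= x.
Proof.
move=> x0 y0 H; rewrite leNgt; apply/negP => xy.
have {x0} [x0|x0] : x = 0 \/ 0 < x.
  by move: x0; rewrite le_eqVlt => /orP[/eqP|]; auto.
  by have := H 0%N; rewrite !expn0 !expr1 x0 mulr0 -x0 leNgt xy.
pose h := y / x - 1.
have h0 : 0 < h by rewrite subr_gt0 ltr_pdivlMr// mul1r.
have qh : y / x = 1 + h by rewrite /h addrC subrK.
(* Since 2^m exceeds C/h, the Bernoulli bound 1 + 2^m h exceeds C. *)
pose m := Num.bound (C / h).
have mC : C / h < (2 ^ m)%:R.
  have [Ch0|Ch0] := ltP (C / h) 0; first exact: lt_le_trans Ch0 _.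
  apply: lt_le_trans (archi_boundP Ch0) _.
  by rewrite ler_nat ltnW// ltn_expl.
have := le_trans (bernoulli_ineq (2 ^ m)%N (ltW h0)) (_ : _ <= C).
rewrite -qh expr_div_n ler_pdivrMr ?exprn_gt0// => /(_ (H m)).
by move: mC; rewrite ltr_pdivrMr//; lra.
Qed.

End RealNorm.

(** * Arithmetic and norm identities in a C*-algebra *)

Section CStarAlgebras.
Context {R : realType} {B : cstarAlgType R}.
Implicit Types a b c e : B.

Lemma cmulDl a b c : cmul (a + b) c = cmul a c + cmul b c.
Proof. exact: (linD (cmul_linearl c)). Qed.
Lemma cmulDr c a b : cmul c (a + b) = cmul c a + cmul c b.
Proof. exact: (linD (cmul_linearr c)). Qed.
Lemma cmulBl a b c : cmul (a - b) c = cmul a c - cmul b c.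
Proof. exact: (linB (cmul_linearl c)). Qed.
Lemma cmulBr c a b : cmul c (a - b) = cmul c a - cmul c b.
Proof. exact: (linB (cmul_linearr c)). Qed.
Lemma cmulZl k a b : cmul (k *: a) b = k *: cmul a b.
Proof. exact: (linZ (cmul_linearl b)). Qed.
Lemma cmulZr k a b : cmul a (k *: b) = k *: cmul a b.
Proof. exact: (linZ (cmul_linearr a)). Qed.
Lemma cmul0l a : cmul 0 a = 0.
Proof. exact: (lin0 (cmul_linearl a)). Qed.

Lemma starD a b : star (a + b) = star a + star b.
Proof. by have := star_antilinear 1 a b; rewrite rmorph1 !scale1r. Qed.
Lemma star0 : star (0 : B) = 0.
Proof. by apply: (addrI (star 0)); rewrite -starD !addr0. Qed.
Lemma starZ k a : star (k *: a) = Num.conj k *: star a.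
Proof. by have := star_antilinear k a 0; rewrite star0 !addr0. Qed.
Lemma starN a : star (- a) = - star a.
Proof. by rewrite -scaleN1r starZ rmorphN1 scaleN1r. Qed.
Lemma starB a b : star (a - b) = star a - star b.
Proof. by rewrite starD starN. Qed.

Lemma nrmM a b : nrm (cmul a b) <= nrm a * nrm b.
Proof. by rewrite -lecR rmorphM/= -!nrmE; exact: cmul_norm_le. Qed.

Lemma nrmM_le (r s : R) a b :
  nrm a <= r -> nrm b <= s -> nrm (cmul a b) <= r * s.
Proof.
by move=> ar bs; apply: le_trans (nrmM a b) _; rewrite ler_pM// nrm_ge0.
Qed.

Lemma nrm_star_sq a : nrm (cmul (star a) a) = nrm a ^+ 2.
Proof.
by apply: (@complexI R); rewrite rmorphXn/= -!nrmE; exact: cstar_identity.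
Qed.

Lemma star_sq_eq0 a : cmul (star a) a = 0 -> a = 0.
Proof.
move=> a0; apply: nrm0_eq0; apply/eqP.
by rewrite -sqrf_eq0 -nrm_star_sq a0 nrm0.
Qed.

Lemma nrm_star a : nrm (star a) = nrm a.
Proof.
suff le_star b : nrm b <= nrm (star b).
  by apply/le_anti; rewrite le_star -{2}(starK a) le_star.
have := nrm_ge0 (star b); have := nrm_ge0 b.
by have := nrmM (star b) b; rewrite nrm_star_sq; nra.
Qed.

Definition csq a := cmul a a.

(** [iter n csq a] is the power a^(2^n). Selfadjointness is carried through the induction, as it
    turns the C*-identity into |a^2| = |a|^2. *)
Lemma nrm_iter_csq n a : star a = a -> nrm (iter n csq a) = nrm a ^+ (2 ^ n).
Proof.
move=> sa; suff /(_ n)[_ ->] : forall m, star (iter m csq a) = iter m csq a /\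
  nrm (iter m csq a) = nrm a ^+ (2 ^ m) by [].
elim=> [|m [IHs IHn]]; first by rewrite expn0 expr1.
rewrite iterS /csq; split; first by rewrite starM IHs.
by rewrite -{1}IHs nrm_star_sq IHn -exprM expnSr.
Qed.

(** * Square roots by a contraction, and unitaries of the unitization *)

Lemma cmul_sandwichB a e f :
  cmul (cmul e a) e - cmul (cmul f a) f =
  cmul (cmul e a) (e - f) + cmul (cmul (e - f) a) f.
Proof. by rewrite cmulBr !cmulBl addrA subrK. Qed.

Lemma sandwich_contraction (r : R) a e f :
  nrm a <= 2^-1 -> nrm e <= r -> nrm f <= r ->
  nrm (cmul (cmul e a) e - cmul (cmul f a) f) <= r * nrm (e - f).
Proof.
move=> a2 er fr; rewrite cmul_sandwichB.
have := nrmM_le (nrmM_le er a2) (lexx (nrm (e - f))).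
have := nrmM_le (nrmM_le (lexx (nrm (e - f))) a2) fr.
by have := nrmD (cmul (cmul e a) (e - f)) (cmul (cmul (e - f) a) f); lra.
Qed.

Lemma nrm_nhalf a : nrm (- (2^-1 : R)%:C%C *: a) = 2^-1 * nrm a.
Proof. by rewrite scaleNr nrmN nrmZR. Qed.

(* The fixed point is e = (sqrt (1 - a^2) - 1) / a, as (1 + a e)^2 = 1 - a^2. *)
Lemma half_sandwich_fixed_point a : nrm a <= 2^-1 ->
  exists2 e, nrm e <= 1 & e = - (2^-1 : R)%:C%C *: (a + cmul (cmul e a) e).
Proof.
move=> a2.
pose T e := - (2^-1 : R)%:C%C *: (a + cmul (cmul e a) e).
have TB (r : R) e f : nrm e <= r -> nrm f <= r ->
    nrm (T e - T f) <= 2^-1 * (r * nrm (e - f)).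
  move=> er fr; rewrite /T -scalerBr nrm_nhalf ler_pM2l//.
  rewrite opprD addrACA subrr add0r; exact: sandwich_contraction.
(* Picard iteration: the iterates stay in the ball of radius 1/2. The limit is only located in the
   unit ball, where [TB] with r = 1 still gives the factor 1/2. *)
pose x n := iter n T 0.
have x2 n : nrm (x n) <= 2^-1.
  elim: n => [|n IH]; first by rewrite nrm0.
  rewrite /x iterS -/(x n) nrm_nhalf.
  have := nrmM_le (nrmM_le IH a2) IH.
  by have := nrmD a (cmul (cmul (x n) a) (x n)); lra.
have xC n m : nrm (x (n + m)%N - x n) <= 2^-1 ^+ n.
  elim: n => [|n IH].
    by rewrite subr0 expr0; apply: le_trans (x2 _) _; lra.
  rewrite addSn /x !iterS -/(x _) -/(x n) exprS.
  have := TB 1 (x (n + m)%N) (x n).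
  by have := x2 n; have := x2 (n + m)%N; lra.
have {xC}[e xe] := half_pow_cauchy_cvg xC.
(* Index 2 is the first at which the error bound 2 * 2^-n, added to 1/2, gives 1. *)
have e1 : nrm e <= 1.
  have : nrm e <= nrm (x 2%N) + nrm (x 2%N - e).
    by have := nrmB (x 2%N) (x 2%N - e); rewrite opprB addrC subrK.
  by have := xe 2%N; rewrite expr2; have := x2 2%N; lra.
exists e => //; apply/eqP; rewrite -subr_eq0; apply/eqP.
(* Compare e and T e with x_(n+1) = T x_n: each of the two distances is at most 2^-n. *)
apply: (@nrm_half_pow_eq0 R _ 2) => n.
have := nrm_triangle (x n.+1) e (T e); rewrite (nrmBC e (x n.+1)).
have := TB 1 (x n) e; have := xe n.+1; rewrite exprS.
by have := xe n; have := x2 n; rewrite /x iterS -/(x n); lra.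
Qed.

Lemma csqB a b : csq a - csq b = cmul a (a - b) + cmul (a - b) b.
Proof. by rewrite cmulBr cmulBl addrA subrK. Qed.

Lemma contract_eq0 (r : R) a : r < 1 -> nrm a <= r * nrm a -> a = 0.
Proof.
by move=> r1 ar; apply: nrm0_eq0; apply/le_anti; have := nrm_ge0 a; nra.
Qed.

(* With d = a e = sqrt (1 - a^2) - 1, the element 1 + d - i a of the
   unitization is unitary. *)
Lemma cmul_unitary_part a : star a = a -> nrm a <= 2^-1 ->
  exists e, let d := cmul a e in
    star d = d /\ cmul (d + 'i *: a) (d - 'i *: a) = - (d + d).
Proof.
move=> sa a2; have [e e1 eE] := half_sandwich_fixed_point a2.
(* As a is selfadjoint, [star e] solves the same fixed-point equation in the same ball, so the
   contraction forces equality. *)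
have se : star e = e.
  apply/esym/eqP; rewrite -subr_eq0; apply/eqP/(@contract_eq0 2^-1); first lra.
  have seE : star e =
      - (2^-1 : R)%:C%C *: (a + cmul (cmul (star e) a) (star e)).
    rewrite {1}eE starZ starD !starM sa cmulA; congr (_ *: _).
    by apply/CrealP; rewrite realN ger0_real// ler0c invr_ge0.
  rewrite {1}eE {1}seE -scalerBr nrm_nhalf opprD addrACA subrr add0r.
  rewrite ler_pM2l// -[leRHS]mul1r.
  by apply: sandwich_contraction => //; rewrite nrm_star.
have ae_le : nrm (cmul a e) <= 2^-1 by have := nrmM_le a2 e1; rewrite mulr1.
have ea_le : nrm (cmul e a) <= 2^-1 by have := nrmM_le e1 a2; rewrite mul1r.
(* Both products are fixed points of c |-> -(a^2 + c^2)/2 in the ball of radius 1/2, where this map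
   contracts by 1/2. *)
have ea : cmul e a = cmul a e.
  apply/esym/eqP; rewrite -subr_eq0; apply/eqP/(@contract_eq0 2^-1); first lra.
  rewrite {1 2}eE cmulZl cmulZr -scalerBr nrm_nhalf cmulDl cmulDr.
  rewrite opprD addrACA subrr add0r !cmulA -(cmulA (cmul a e)).
  rewrite -(cmulA _ e a) -/(csq (cmul a e)) -/(csq (cmul e a)) csqB.
  set c := _ - _.
  have := nrmM_le ae_le (lexx (nrm c)); have := nrmM_le (lexx (nrm c)) ea_le.
  by have := nrmD (cmul (cmul a e) c) (cmul c (cmul e a)); lra.
(* This is (1 + d)^2 = 1 - a^2 with the unit cancelled. *)
exists e => d; have dE : - (d + d) = csq a + csq d.
  have -> : csq a + csq d = cmul a (a + cmul (cmul e a) e).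
    by rewrite cmulDr !cmulA -(cmulA (cmul a e)).
  rewrite /d {1 2}eE cmulZr.
  rewrite -scalerDl -scaleNr opprD opprK -rmorphD.
  by rewrite (_ : _ + _ = 1) ?rmorph1 ?scale1r//; lra.
split; first by rewrite /d starM sa se ea.
rewrite dE cmulBr !cmulDl !cmulZl !cmulZr scalerA -expr2 sqrCi scaleN1r.
(* Commutation removes the mixed terms, leaving a^2 + d^2. *)
have da : cmul d a = cmul a d by rewrite /d -cmulA ea.
by rewrite da opprB addrC [cmul d d + _]addrC subrKA.
Qed.

Lemma nrm_unitary_part d b : star (d - 'i *: b) = d + 'i *: b ->
  cmul (d + 'i *: b) (d - 'i *: b) = - (d + d) -> nrm b <= 2.
Proof.
set g := d - _ => gE; rewrite -gE => /(congr1 nrm).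
rewrite nrm_star_sq => g2.
have dd : d + d = g + star g by rewrite gE /g addrACA addNr addr0.
have bb : 'i *: (b + b) = star g - g.
  by rewrite gE /g opprB [RHS]addrC subrKA scalerDr.
have b2 : nrm (b + b) = 2 * nrm b.
  by rewrite -mulr2n -scaler_nat -(rmorph_nat (real_complex R)) nrmZR.
have := nrmB (star g) g; rewrite -bb nrmZi b2 nrm_star.
have := nrmD g (star g); rewrite -dd -(nrmN (d + d)) -g2 nrm_star.
by have := nrm_ge0 g; nra.
Qed.

End CStarAlgebras.

(** * Hilbert modules: calculus, separation and faithfulness of the action *)

Section HilbertModules.
Context {R : realType} {B : cstarAlgType R} {E : hilbertModType B}.
Implicit Types (x y z w : E) (a b c : B) (u v : E -> E).

Lemma ractDr x a b : ract x (a + b) = ract x a + ract x b.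
Proof. exact: (linD (ract_linearr x)). Qed.
Lemma ractBr x a b : ract x (a - b) = ract x a - ract x b.
Proof. exact: (linB (ract_linearr x)). Qed.
Lemma ractZr k x b : ract x (k *: b) = k *: ract x b.
Proof. exact: (linZ (ract_linearr x)). Qed.
Lemma ract0r x : ract x (0 : B) = 0.
Proof. exact: (lin0 (ract_linearr x)). Qed.

Lemma ipDr x y z : ip x (y + z) = ip x y + ip x z.
Proof. exact: (linD (ip_linearr x)). Qed.
Lemma ipBr x y z : ip x (y - z) = ip x y - ip x z.
Proof. exact: (linB (ip_linearr x)). Qed.
Lemma ipZr k x y : ip x (k *: y) = k *: ip x y.
Proof. exact: (linZ (ip_linearr x)). Qed.
Lemma ip0r x : ip x 0 = 0.
Proof. exact: (lin0 (ip_linearr x)). Qed.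
Lemma ipBl x y z : ip (x - y) z = ip x z - ip y z.
Proof. by rewrite -star_ip ipBr starB !star_ip. Qed.
Lemma ip_ractl x y b : ip (ract x b) y = cmul (star b) (ip x y).
Proof. by rewrite -star_ip ip_ractr starM star_ip. Qed.

Lemma nrm_ip x : nrm (ip x x) = nrm x ^+ 2.
Proof.
by apply: (@complexI R); rewrite rmorphXn/= -!nrmE norm_ip sqrtCK.
Qed.

Lemma nrm_ract x b : nrm (ract x b) <= nrm x * nrm b.
Proof.
have := nrm_ip (ract x b); rewrite ip_ractr ip_ractl.
have := nrmM_le (nrmM (star b) (ip x x)) (lexx (nrm b)).
rewrite nrm_star nrm_ip => le_sq sqE.
rewrite -(@ler_pXn2r _ 2) ?nnegrE ?mulr_ge0 ?nrm_ge0// -sqE.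
by apply: le_trans le_sq _; rewrite exprMn mulrC mulrA -expr2 mulrC.
Qed.

(** Taking x = y = w gives <w, w>^2 = <w, w<w, w>> = 0, and <w, w> is selfadjoint. *)
Lemma ract_ip_eq0 w : (forall x y, ract x (ip w y) = 0) -> w = 0.
Proof.
move=> w0; apply/ip_definite/star_sq_eq0.
by rewrite star_ip -ip_ractr w0 ip0r.
Qed.

Lemma linear_span_near (A : set B) a (r : R) : dense (linear_span A) -> 0 < r ->
  exists2 s, linear_span A s & nrm (s - a) < r.
Proof.
move=> Ad r0; have rC0 : 0 < r%:C%C :> R[i] by rewrite ltcR.
have [|s [sr As]] := Ad (ball a r%:C%C) _ (@ball_open _ _ _ _).
  by exists a; exact: ballxx.
by exists s => //; move: sr; rewrite -ball_normE/= nrmE ltcR nrmBC.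
Qed.

Lemma linear_span_ind (A P : set B) : P 0 ->
  (forall a b, P a -> P b -> P (a + b)) -> (forall k a, A a -> P (k *: a)) ->
  linear_span A `<=` P.
Proof.
move=> P0 PD PZ _ [n [k [f [Af ->]]]].
by apply: big_ind => // i _; exact: PZ.
Qed.

Lemma full_faithful b : full E -> (forall x, ract x b = 0) -> b = 0.
Proof.
move=> fullE xb0.
have sb0 : linear_span [set ip x y | x in [set: E] & y in [set: E]] `<=`
    [set s | cmul s b = 0].
  apply: linear_span_ind => [|s t s0 t0|k _ [x _ [y _ <-]]]/=.
  - exact: cmul0l.
  - by rewrite cmulDl s0 t0 addr0.
  - by rewrite cmulZl -ip_ractr xb0 ip0r scaler0.
apply: (@nrm_half_pow_eq0 R _ 1) => n.
have [s /sb0/= sb] := linear_span_near (star b) fullE (half_pow_gt0 n).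
have := nrmM (s - star b) b; rewrite cmulBl sb sub0r nrmN nrm_star_sq mul1r.
by have := nrm_ge0 b; have := nrm_ge0 (s - star b); nra.
Qed.

(** Each identity is tested against vectors uz, which exhaust E. Linearity comes first because
    injectivity uses u(x - y) = ux - uy. *)
Lemma generalized_unitary_ternary u :
  generalized_unitary u -> ternary_automorphism u.
Proof.
move=> [us [phi [phil phiM phistar phib] uphi]].
have ip_sep w : (forall z, ip (u z) w = 0) -> w = 0.
  by move=> zw; apply: ip_definite; have [z zE] := us w; rewrite -{1}zE.
have ul : linear u.
  move=> k x y; apply/eqP; rewrite -subr_eq0; apply/eqP/ip_sep => z.
  by rewrite ipBr ipDr ipZr !uphi ipDr ipZr (linD phil) (linZ phil) subrr.
split => //.
  have uI : injective u.
    move=> x y uxy; apply/eqP; rewrite -subr_eq0; apply/eqP/ip_definite.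
    apply: (bij_inj phib); rewrite -uphi (linB ul) uxy subrr ip0r.
    by rewrite (lin0 phil).
  have /choice[v vK] := us.
  by exists v => // x; apply: uI; rewrite vK.
move=> x y z; apply/eqP; rewrite -subr_eq0; apply/eqP/ip_sep => w.
by rewrite ipBr ip_ractr !uphi ip_ractr phiM subrr.
Qed.

Lemma ternary_group : transformation_group (@ternary_automorphism R B E).
Proof.
split.
- by split => //; exists id.
- move=> u v [ul ub uT] [vl vb vT]; split.
  + by move=> k x y /=; rewrite vl ul.
  + exact: bij_comp.
  + by move=> x y z /=; rewrite vT uT.
- move=> u [ul [v uK vK] uT]; exists v; split => //; split.
  + exact: lin_can uK vK.
  + by exists u.
  + by move=> x y z; apply: (can_inj uK); rewrite uT !vK.
Qed.

(** For a ternary [u] this is the graph of the automorphism sought; as a relation it can be used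
    before any b is known to exist. *)
Definition transports u a b := forall x, u (ract x a) = ract (u x) b.

(** * The correspondence on the algebra induced by a ternary automorphism *)

Section Transport.
Context {u : E -> E}.
Hypothesis fullE : full E.
Hypothesis uT : ternary_automorphism u.

Let ul : linear u. Proof. by case: uT. Qed.
Let ub : bijective u. Proof. by case: uT. Qed.
Let us y : exists x, u x = y. Proof. by have [v _ vK] := ub; exists (v y). Qed.
Let u_ip x y z : u (ract x (ip y z)) = ract (u x) (ip (u y) (u z)).
Proof. by case: uT. Qed.

Lemma transports_ip x y : transports u (ip x y) (ip (u x) (u y)).
Proof. by move=> z; exact: u_ip. Qed.

Lemma transports_unique a b c : transports u a b -> transports u a c -> b = c.
Proof.
move=> ab ac; apply/eqP; rewrite -subr_eq0; apply/eqP/full_faithful => // y.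
by have [x <-] := us y; rewrite ractBr -ab -ac subrr.
Qed.

Lemma transports0 : transports u 0 0.
Proof. by move=> x; rewrite !ract0r (lin0 ul). Qed.

Lemma transportsD a b c d :
  transports u a b -> transports u c d -> transports u (a + c) (b + d).
Proof. by move=> ab cd x; rewrite !ractDr (linD ul) ab cd. Qed.

Lemma transportsZ k a b : transports u a b -> transports u (k *: a) (k *: b).
Proof. by move=> ab x; rewrite !ractZr (linZ ul) ab. Qed.

Lemma transportsM a b c d :
  transports u a b -> transports u c d -> transports u (cmul a c) (cmul b d).
Proof. by move=> ab cd x; rewrite !ractM cd ab. Qed.

Lemma transports_star a b : transports u a b -> transports u (star a) (star b).
Proof.
move=> ab x; apply/eqP; rewrite -subr_eq0; apply/eqP/ract_ip_eq0 => z' y'.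
have [z <-] := us z'; have [y <-] := us y'.
rewrite ipBl ip_ractl starK ractBr -u_ip ip_ractl starK.
by rewrite !ractM u_ip ab subrr.
Qed.

Lemma transportsB a b c d :
  transports u a b -> transports u c d -> transports u (a - c) (b - d).
Proof. by move=> ab cd x; rewrite !ractBr (linB ul) ab cd. Qed.

Lemma transportsN a b : transports u a b -> transports u (- a) (- b).
Proof.
by rewrite -(sub0r a) -(sub0r b); apply: transportsB; exact: transports0.
Qed.

(** These elements form a right ideal containing all inner products. The condition concerns a B
    because the auxiliary element d has the form a e. *)
Definition right_transportable a :=
  forall c, exists b, transports u (cmul a c) b.

(** * Norm bounds for the correspondence *)

Lemma transports_half_bound a b : star a = a -> nrm a <= 2^-1 ->
  right_transportable a -> transports u a b -> nrm b <= 2.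
Proof.
move=> sa a2 aT ab; have [e [/= sd dE]] := cmul_unitary_part sa a2.
(* No image of [e] itself is at hand, but a e has one by [aT]. *)
have [d' dd'] := aT e; set d := cmul a e in sd dE dd'.
have sb : star b = b.
  by apply: (transports_unique _ ab); rewrite -sa; exact: transports_star.
have sd' : star d' = d'.
  by apply: (transports_unique _ dd'); rewrite -sd; exact: transports_star.
apply: (@nrm_unitary_part R B d').
  by rewrite starB sd' starZ sb conjCi scaleNr opprK.
have iab := transportsZ 'i ab.
have gg := transportsM (transportsD dd' iab) (transportsB dd' iab).
(* The images satisfy the same unitarity relation, since both of its sides are images of one
   element. *)
apply: transports_unique gg _.
by rewrite dE; exact/transportsN/transportsD.
Qed.

Lemma transports_selfadjoint_bound a b : star a = a -> right_transportable a ->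
  transports u a b -> nrm b <= 4 * nrm a.
Proof.
move=> sa aT ab; have := nrm_ge0 a; rewrite le_eqVlt => /orP[/eqP a0|a0].
  have {}a0 : a = 0 by apply: nrm0_eq0.
  have -> : b = 0.
    by apply: transports_unique ab _; rewrite a0; exact: transports0.
  by rewrite a0 nrm0 mulr0.
(* Rescaling brings the norm to exactly 1/2; the bound 2 then becomes 2/t = 4|a|. *)
pose t := 2^-1 * (nrm a)^-1.
have t0 : 0 <= t by rewrite mulr_ge0// ?invr_ge0 ltW.
have ta : t * nrm a = 2^-1 by rewrite -mulrA mulVf ?mulr1// gt_eqF.
have := @transports_half_bound (t%:C%C *: a) (t%:C%C *: b).
rewrite starZ (CrealP (ger0_real _)) ?ler0c// sa !nrmZR// ta lexx.
move=> /(_ erefl isT); rewrite -(ler_pM2r a0) mulrAC ta => H.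
suff : 2^-1 * nrm b <= 2 * nrm a by lra.
apply: H; last exact: transportsZ.
move=> c; have [d acd] := aT c; exists (t%:C%C *: d).
by rewrite cmulZl; exact: transportsZ.
Qed.

Lemma transports_iter_csq n a b : right_transportable a -> transports u a b ->
  right_transportable (iter n csq a) /\
  transports u (iter n csq a) (iter n csq b).
Proof.
move=> aT ab; elim: n => [//|n [IH1 IH2]]; rewrite !iterS; split.
  by move=> c; rewrite /csq -cmulA; exact: IH1.
exact: transportsM.
Qed.

Lemma transports_bound a b : right_transportable a -> transports u a b ->
  nrm b <= nrm a.
Proof.
have sa_le a' b' : star a' = a' -> right_transportable a' ->
    transports u a' b' -> nrm b' <= nrm a'.
  move=> sa aT ab; apply: (@le_of_pow2_le R _ _ 4) => [||n]; try exact: nrm_ge0.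
  have sb : star b' = b'.
    by apply: (transports_unique _ ab); rewrite -sa; exact: transports_star.
  rewrite -!nrm_iter_csq//; have [aTn abn] := transports_iter_csq n aT ab.
  apply: transports_selfadjoint_bound => //.
  by elim: n {aTn abn} => //= n IH; rewrite /csq starM IH.
move=> aT ab; have : nrm (cmul b (star b)) <= nrm (cmul a (star a)).
  apply: sa_le; first by rewrite starM starK.
  - by move=> c; rewrite -cmulA; exact: aT.
  - exact: transportsM ab (transports_star ab).
rewrite -{1}(starK b) -{1}(starK a) !nrm_star_sq !nrm_star.
by rewrite ler_pXn2r// nnegrE nrm_ge0.
Qed.

(** * Extension from the span of the inner products to the whole algebra *)

Lemma right_transportable_ip x y : right_transportable (ip x y).
Proof. by move=> c; rewrite -ip_ractr; eexists; exact: transports_ip. Qed.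

Lemma ternary_le x : nrm (u x) <= nrm x.
Proof.
have := transports_bound (@right_transportable_ip x x) (@transports_ip x x).
by rewrite !nrm_ip ler_pXn2r// nnegrE nrm_ge0.
Qed.

(** Without a unit, an image of s is not read off from images of the products s c, so both
    properties are carried along. *)
Lemma span_transportable s :
  linear_span [set ip x y | x in [set: E] & y in [set: E]] s ->
  right_transportable s /\ exists t, transports u s t.
Proof.
pose P := [set s | right_transportable s /\ exists t, transports u s t].
apply: (@linear_span_ind _ P).
- split; last by exists 0; exact: transports0.
  by move=> c; exists 0; rewrite cmul0l; exact: transports0.
- move=> a b [aT [a' aa']] [bT [b' bb']]; split; last first.
    by exists (a' + b'); exact: transportsD.
  move=> c; have [a1 ?] := aT c; have [b1 ?] := bT c.
  by exists (a1 + b1); rewrite cmulDl; exact: transportsD.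
- move=> k _ [x _ [y _ <-]]; split; last first.
    by eexists; apply: transportsZ; exact: transports_ip.
  move=> c; have [a1 ?] := right_transportable_ip x y c.
  by exists (k *: a1); rewrite cmulZl; exact: transportsZ.
Qed.

Lemma transports_total a : exists b, transports u a b.
Proof.
(* With the factor 1/4, two approximation errors add up to less than 2^-n. *)
have q0 n : 0 < 4^-1 * 2^-1 ^+ n :> R by rewrite mulr_gt0// half_pow_gt0.
have /choice[s sP] n : exists st : B * B, [/\ right_transportable st.1,
    transports u st.1 st.2 & nrm (st.1 - a) < 4^-1 * 2^-1 ^+ n].
  have [s /span_transportable[sT [t st]] sa] := linear_span_near a fullE (q0 n).
  by exists (s, t).
have close m n : nrm ((s m).2 - (s n).2) <= nrm ((s m).1 - (s n).1).
  have [mT mt _] := sP m; have [nT nt _] := sP n.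
  apply: transports_bound; last exact: transportsB.
  move=> c; have [d cd] := mT c; have [d' cd'] := nT c.
  by exists (d - d'); rewrite cmulBl; exact: transportsB.
have [n k|b bP] := @half_pow_cauchy_cvg R _ (fun n => (s n).2).
  have := close (n + k)%N n; have := nrm_triangle a (s (n + k)%N).1 (s n).1.
  rewrite (nrmBC a); have [_ _] := sP n; have [_ _] := sP (n + k)%N.
  have : 2^-1 ^+ (n + k) <= 2^-1 ^+ n :> R.
    by apply: ler_wiXn2l; [lra | lra | exact: leq_addr].
  by have := half_pow_gt0 (R := R) n; lra.
exists b => x; apply/eqP; rewrite -subr_eq0; apply/eqP.
(* The first summand bounds the error from replacing a by its approximant, the second that from
   replacing b by the approximant's image. *)
apply: (@nrm_half_pow_eq0 R _ (nrm x * 4^-1 + nrm (u x) * 2)) => n.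
have [_ st sa] := sP n.
have := nrm_triangle (u (ract x (s n).1)) (u (ract x a)) (ract (u x) b).
rewrite -(linB ul) -ractBr st -ractBr.
have := ternary_le (ract x (a - (s n).1)).
have := nrm_ract x (a - (s n).1); rewrite (nrmBC a).
have := nrm_ract (u x) ((s n).2 - b).
have := ler_wpM2l (nrm_ge0 x) (ltW sa).
by have := ler_wpM2l (nrm_ge0 (u x)) (bP n); lra.
Qed.

End Transport.

(** * Isometry, the induced automorphism, and equality of the two groups *)

Lemma ternary_isometry u x :
  full E -> ternary_automorphism u -> nrm (u x) = nrm x.
Proof.
move=> fullE uT; have [_ _ inv] := ternary_group.
have [v [vT uK _]] := inv u uT.
by apply/le_anti; rewrite ternary_le//= -{1}(uK x) ternary_le.
Qed.

Lemma ternary_generalized_unitary u :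
  full E -> ternary_automorphism u -> generalized_unitary u.
Proof.
move=> fullE uT; have [ul ub _] := uT; have [_ _ inv] := ternary_group.
have [v [vT uK vK]] := inv u uT.
split; first by move=> y; exists (v y).
have /choice[phi phiP] := transports_total fullE uT.
(* The inverse of [u] induces the inverse of [phi]. *)
have /choice[psi psiP] := transports_total fullE vT.
(* Each algebraic law for [phi] holds because both sides are images of the same element. *)
have uniq := transports_unique fullE uT.
exists phi; last by move=> x y; apply: uniq (phiP _); exact: transports_ip.
split.
- move=> k a b; apply: uniq (phiP _) _.
  by apply: (transportsD uT) => //; exact: transportsZ.
- by move=> a b; apply: uniq (phiP _) _; exact: transportsM.
- by move=> a; apply: uniq (phiP _) _; exact: transports_star.
exists psi => a.
- apply: (transports_unique fullE vT) (psiP _) _ => y.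
  by rewrite -{1}(vK y) -phiP uK.
- apply: uniq (phiP _) _ => x.
  by rewrite -{1}(uK x) -psiP vK.
Qed.

Lemma generalized_unitaryE : full E ->
  @generalized_unitary R B E = @ternary_automorphism R B E.
Proof.
move=> fullE; apply/seteqP; split => u.
  exact: generalized_unitary_ternary.
exact: ternary_generalized_unitary.
Qed.

End HilbertModules.

Theorem corollary2p4 (R : realType) (B : cstarAlgType R) (E : hilbertModType B)
    (fullE : full E) :
  [/\ transformation_group (@generalized_unitary R B E),
      transformation_group (@ternary_automorphism R B E)
    & @generalized_unitary R B E = @ternary_automorphism R B E] /\
  (forall u : R -> E -> E,
     dynamical_system u <->
     (C0_group u /\ forall t : R, ternary_automorphism (u t))).
Proof.
rewrite /dynamical_system generalized_unitaryE//.
split; first by split => //; exact: ternary_group.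
move=> u; split => [[uG uC uT]|[[uG uC _] uT]]; last by [].
(* Fullness makes a ternary automorphism isometric, which gives the isometry clause of
   [C0_group]. *)
split=> //; split => // t; have [ul _ _] := uT t.
by split=> // x; rewrite !nrmE ternary_isometry.
Qed.
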